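(* Let $0<p<1$ and let $N$ be a positive integer. Then the polynomial $K_{N+2}(x;p,N)$ (in the variable $x$) has $N+2$ real zeros (counted with multiplicity), namely $$x=0,1,\dots,N,\; N+1-p(N+2).$$
   Context: The Pochhammer symbol is $(\alpha)_0=1$ and $(\alpha)_m=\alpha(\alpha+1)\cdots(\alpha+m-1)$ for $m\ge 1$. For $n\in\{0,1,2,\dots\}$, $a\in\mathbb{R}$ and real $p\neq 0$, the polynomial $K_n(x;p,a)$ of degree $n$ in $x$ is given by $$K_n(x;p,a)=\sum_{k=0}^n\frac{(-n)_k(-x)_k(-a+k)_{n-k}}{k!\,p^k}.$$ *)

(* Defs.v *)
From mathcomp Require Import all_boot all_order all_algebra.
From mathcomp Require Import reals.

Set Implicit Arguments.
Unset Strict Implicit.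
Unset Printing Implicit Defensive.

Import Order.TTheory GRing.Theory Num.Theory.

Local Open Scope ring_scope.

(* The base is any ring, so that (-x)_k can be formed with x the
   indeterminate of a polynomial ring. *)
Definition pochhammer (A : nzRingType) (x : A) (m : nat) : A :=
  \prod_(i < m) (x + i%:R).

(* K_n(x; p, a), as a polynomial in x = 'X; meant for p != 0. *)
Definition krawtchouk (R : realType) (n : nat) (p a : R) : {poly R} :=
  \sum_(k < n.+1)
    (pochhammer (- n%:R) k * pochhammer (- a + k%:R) (n - k)
       / (k`!%:R * p ^+ k)) *: pochhammer (- 'X) k.

(* Main.v *)
Require Import Defs.
From mathcomp Require Import all_boot all_order all_algebra.
From mathcomp Require Import reals.
From mathcomp Require Import ring.

Set Implicit Arguments.
Unset Strict Implicit.
Unset Printing Implicit Defensive.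

Import Order.TTheory GRing.Theory Num.Theory.
Local Open Scope ring_scope.

(** In [K_n(x; p, a)] with [n = N + 2] and [a = N], the coefficient of
    [(-x)_k] contains [(k - N)_{N + 2 - k}], which runs through
    [k - N, ..., 1] and so meets [0] as soon as [k <= N].  Only the terms
    [k = N + 1] and [k = N + 2] survive.  They share the factor
    [(-x)_{N+1} = (-1)^{N+1} x (x - 1) ... (x - N)], and what is left is the
    linear polynomial [(N + 1 - x) - p (N + 2)] up to a constant.  Hence
    [p^{N+2} K_{N+2}(x; p, N)] is the monic polynomial whose roots are the
    listed ones ([krawtchouk_factor]); its degree and its root multiplicities
    are then those of a product of linear factors ([mu_prod_XsubC]). *)

Lemma pochhammerS (A : nzRingType) (x : A) (m : nat) :
  pochhammer x m.+1 = pochhammer x m * (x + m%:R).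
Proof. by rewrite /pochhammer big_ord_recr. Qed.

(** With a falling factorial on the right the formula also covers [n < k],
    where both sides vanish. *)
Lemma pochhammer_oppn (A : nzRingType) (n k : nat) :
  pochhammer (- n%:R : A) k = (-1) ^+ k * (n ^_ k)%:R.
Proof.
elim: k => [|k IHk]; first by rewrite /pochhammer big_ord0 ffactn0 mulr1.
rewrite pochhammerS IHk ffactnSr natrM exprS mulN1r mulNr.
have [le_kn | lt_nk] := leqP k n; last first.
  by rewrite ffact_small // mulr0 !mul0r mulr0 oppr0.
by rewrite natrB // -mulrA -mulrN -mulrN opprB addrC.
Qed.

(** Reading [(-x)_k] through its roots makes the zeros [0, ..., N] appear
    verbatim as the index sequence of the product. *)
Lemma pochhammer_oppX (A : comNzRingType) (k : nat) :
  pochhammer (- 'X : {poly A}) k =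
  (-1) ^+ k *: \prod_(z <- [seq i%:R | i <- iota 0 k]) ('X - z%:P).
Proof.
elim: k => [|k IHk]; first by rewrite /pochhammer big_ord0 big_nil scale1r.
rewrite pochhammerS IHk.
rewrite -[in iota 0 k.+1]addn1 iotaD map_cat big_cat big_seq1 add0n.
rewrite exprS mulN1r scaleNr -scalerAl -scalerN -mulrN opprB.
by rewrite polyC_natr addrC.
Qed.

(** Both surviving coefficients are written as multiples of [1 / p^{N+2}], so
    that dividing it out leaves [p (N + 2) - (N + 1 - x)] times
    [x (x - 1) ... (x - N)]: the sign of [(-n)_{n-1}] cancels that of
    [(-x)_{N+1}]. *)
Lemma krawtchouk_factor (R : realType) (p : R) (N : nat) : p != 0 ->
  krawtchouk N.+2 p N%:R =
  (p ^+ N.+2)^-1 *: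
    \prod_(z <- rcons [seq i%:R | i <- iota 0 N.+1]
                  (N%:R + 1 - p * (N%:R + 2))) ('X - z%:P).
Proof.
move=> p0; rewrite -cats1 big_cat big_seq1.
set Q := \prod_(z <- _) _; set w := _ - p * _.
rewrite /krawtchouk big_ord_recr big_ord_recr /= big1 ?add0r; last first.
  (* Here [(k - N)_{N + 2 - k}] has more factors than [N - k], so it hits 0. *)
  move=> k _; have le_kN : (k <= N)%N by rewrite -ltnS.
  have -> : - N%:R + k%:R = - (N - k)%:R :> R by rewrite natrB // opprB addrC.
  rewrite [X in _ * X / _]pochhammer_oppn ffact_small.
    by rewrite !(mulr0, mul0r) scale0r.
  by rewrite subSn ?subSn // leqW.
have ffact_pred : N.+2 ^_ N.+1 = N.+2`!.
  by rewrite -ffactnn [RHS]ffactnSr subSnn muln1.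
have fact_neq0 m : m`!%:R != 0 :> R by rewrite pnatr_eq0 -lt0n fact_gt0.
rewrite subnn subSnn.
have -> : pochhammer (- N%:R + N.+1%:R : R) 1 = 1.
  by rewrite /pochhammer big_ord1 addr0 -natr1 addKr.
rewrite [pochhammer _ 0]big_ord0 !mulr1 !pochhammer_oppn ffactnn ffact_pred.
have -> : (-1) ^+ N.+1 * (N.+2)`!%:R / ((N.+1)`!%:R * p ^+ N.+1)
    = (p ^+ N.+2)^-1 * ((-1) ^+ N.+1 * (p * N.+2%:R)).
  rewrite factS natrM [p ^+ N.+2]exprS; field.
  by rewrite p0 expf_neq0 // fact_neq0.
have -> : (-1) ^+ N.+2 * (N.+2)`!%:R / ((N.+2)`!%:R * p ^+ N.+2)
    = (p ^+ N.+2)^-1 * (-1) ^+ N.+2.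
  by field; rewrite expf_neq0 // fact_neq0.
rewrite [pochhammer _ N.+2]pochhammerS pochhammer_oppX -/Q.
rewrite -!(scalerA (p ^- N.+2)) -scalerDr; congr (_ *: _).
set e := (-1) ^+ N.+1; have ee : e * e = 1 by rewrite -expr2 sqrr_sign.
rewrite [(-1) ^+ N.+2]exprS mulN1r -/e -scalerAl !scalerA mulNr ee scaleN1r.
rewrite mulrAC ee mul1r -mul_polyC /w.
rewrite !(polyC_natr, polyCD, polyCN, polyCM).
by ring.
Qed.

Theorem corollary9 (R : realType) (p : R) (N : nat)
    (hp : 0 < p < 1) (hN : (0 < N)%N) :
  let K : {poly R} := krawtchouk N.+2 p N%:R in
  let zeros : seq R :=
    rcons [seq i%:R | i <- iota 0 N.+1] (N%:R + 1 - p * (N%:R + 2)) in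
  [/\ size K = N.+3,
      size zeros = N.+2
    & forall x : R, mup x K = count_mem x zeros].
Proof.
move=> K zeros; have p0 : p != 0 by case/andP: hp => /lt0r_neq0.
have c0 : (p ^+ N.+2)^-1 != 0 by rewrite invr_eq0 expf_neq0.
have size_zeros : size zeros = N.+2 by rewrite size_rcons size_map size_iota.
rewrite /K krawtchouk_factor // -/zeros; split=> // [|x].
  by rewrite size_scale // size_prod_XsubC size_zeros.
by rewrite -mul_polyC mupMr ?rootC // mu_prod_XsubC.
Qed.
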